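(* Let $\xi:\mathbb{R}^+\to[0,1]$ be a fuzzy interval of class $\mathcal{F}_c(\mathbb{R}^+)$, let $\xi_l$ be its left fuzzy endpoint, let $\xi_d$ be the generalized inverse of $\xi_l$, and let $\overleftarrow{\xi_d}$ be the re-inversion of $\xi_d$ (all as defined in the context). Then $$\overleftarrow{\xi_d}(x)=\xi_l(x)\qquad\text{for all } x\in\mathbb{R}.$$
   Context: Convention: $\mathbb{R}^+=[0,\infty)$. A fuzzy interval of class $\mathcal{F}_c(\mathbb{R}^+)$ is a function $\xi:\mathbb{R}^+\to[0,1]$ for which there are real numbers $0\le l\le \underline{m}\le\overline{m}\le r$ such that: (1) the closure of $\{x\in\mathbb{R}^+:\xi(x)>0\}$ is the closed interval $[l,r]$; (2) $\{x\in\mathbb{R}^+:\xi(x)=1\}=[\underline{m},\overline{m}]\subseteq[l,r]$; (3) the restriction of $\xi$ to $[l,\underline{m}]$ is non-decreasing and right-continuous; (4) the restriction of $\xi$ to $[\overline{m},r]$ is non-increasing and left-continuous. The left fuzzy endpoint $\xi_l$ is the function equal to $\xi$ on $[l,\underline{m}]$ (so $\xi_l(\underline{m})=1$), regarded as a function $\mathbb{R}\to[0,1]$ by setting it equal to $0$ outside $[l,\underline{m}]$. Its support is $\operatorname{supp}(\xi_l)=\overline{\{x:\xi_l(x)>0\}}=[l,\underline{m}]$; write $\underline{\operatorname{supp}(\xi_l)}=l$ and $\overline{\operatorname{supp}(\xi_l)}=\underline{m}$ for its lower and upper endpoints. The generalized inverse $\xi_d:[0,1]\to\mathbb{R}^+$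 of $\xi_l$ is $$\xi_d(\alpha)=\begin{cases}\inf\{x:\xi_l(x)\ge\alpha\} & \text{for }\alpha\in(0,1],\\ \underline{\operatorname{supp}(\xi_l)} & \text{for }\alpha=0.\end{cases}$$ The re-inversion of $\xi_d$ is the function $\overleftarrow{\xi_d}:\mathbb{R}\to[0,1]$ given by $$\overleftarrow{\xi_d}(x)=\begin{cases}\inf\{\alpha\in[0,1]:\xi_d(\alpha)>x\} & \text{for }x\in\bigl[\underline{\operatorname{supp}(\xi_l)},\overline{\operatorname{supp}(\xi_l)}\bigr),\\ 1 & \text{for }x=\overline{\operatorname{supp}(\xi_l)},\\ 0 & \text{for }x\notin\operatorname{supp}(\xi_l).\end{cases}$$ *)

(* Defs.v *)
From mathcomp Require Import all_boot all_order all_algebra.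
From mathcomp Require Import all_classical all_reals all_analysis.

Set Implicit Arguments.
Unset Strict Implicit.
Unset Printing Implicit Defensive.

Import Order.TTheory GRing.Theory Num.Theory.
Import numFieldNormedType.Exports.
Local Open Scope classical_set_scope.
Local Open Scope ring_scope.

Section FuzzyIntervals.
Context {R : realType}.
Implicit Types (f xi xl xd : R -> R) (A S : set R).

(* One-sided continuity of the restriction of [f] to [A]: the filter
   [within A x^'+] is trivial at the right end of an interval [A], so nothing
   is required there (dually on the left). *)
Definition right_continuous_on A f :=
  forall x, A x -> f y @[y --> within A x^'+] --> f x.

Definition left_continuous_on A f :=
  forall x, A x -> f y @[y --> within A x^'-] --> f x.

(* A function [0, +oo[ -> [0, 1] is represented by a total function on [R]
   whose values at negative arguments are unconstrained and never used. *)
Record fuzzy_interval xi (l m1 m2 r : R) : Prop := FuzzyInterval {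
  fuzzy_fun : set_fun `[0, +oo[%classic `[0, 1]%classic xi;
  fuzzy_order : [/\ 0 <= l, l <= m1, m1 <= m2 & m2 <= r];
  fuzzy_supp : closure [set x | 0 <= x /\ 0 < xi x] = `[l, r]%classic;
  fuzzy_core : [set x | 0 <= x /\ xi x = 1] = `[m1, m2]%classic;
  fuzzy_left_homo : {in `[l, m1] &, {homo xi : x y / x <= y}};
  fuzzy_left_cont : right_continuous_on `[l, m1]%classic xi;
  fuzzy_right_homo : {in `[m2, r] &, {homo xi : x y /~ x <= y}};
  fuzzy_right_cont : left_continuous_on `[m2, r]%classic xi
}.

Definition left_endpoint xi (l m1 : R) : R -> R :=
  fun x => if l <= x <= m1 then xi x else 0.

Definition supp xl : set R := closure [set x | 0 < xl x].

(* Only the values at [alpha] in [0, 1] are meaningful. *)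
Definition gen_inverse xl : R -> R :=
  fun alpha => if alpha == 0 then inf (supp xl)
               else inf [set x | alpha <= xl x].

(* [S] is the support of the left fuzzy endpoint, a compact interval, so that
   the last branch is the case [x \notin S]. *)
Definition reinversion S xd : R -> R :=
  fun x => if inf S <= x < sup S
           then inf [set alpha | 0 <= alpha <= 1 /\ x < xd alpha]
           else if x == sup S then 1 else 0.

End FuzzyIntervals.

(* Main.v *)
(** Monotonicity and right continuity give, for [l <= x < m1] and
    [0 < alpha <= 1], the Galois-type equivalence
    [x < xi_d alpha <-> xi x < alpha].  Hence the set whose infimum defines the
    re-inversion at [x] is the interval [`]xi x, 1]], and [xi x < 1] since
    [x] lies to the left of the core. *)
Require Import Defs.
From mathcomp Require Import all_boot all_order all_algebra.
From mathcomp Require Import all_classical all_reals all_analysis.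

Import Order.TTheory GRing.Theory Num.Theory.
Import numFieldNormedType.Exports.
Local Open Scope ring_scope.

Section LeftEndpoint.
Local Open Scope classical_set_scope.
Context {R : realType} {xi : R -> R} {l m1 m2 r : R}.
Context (hxi : fuzzy_interval xi l m1 m2 r).

Local Notation xi_l := (left_endpoint xi l m1).
Local Notation xi_d := (gen_inverse xi_l).

Lemma left_endpoint_in {x : R} : l <= x <= m1 -> xi_l x = xi x.
Proof. by rewrite /left_endpoint => ->. Qed.

Lemma left_endpoint_gt0_in {x : R} : 0 < xi_l x -> l <= x <= m1.
Proof. by rewrite /left_endpoint; case: ifP => //; rewrite ltxx. Qed.

Lemma fuzzy_lo_ge0 : 0 <= l.
Proof. by case: (fuzzy_order hxi). Qed.

Lemma fuzzy_lo_le_core : l <= m1.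
Proof. by case: (fuzzy_order hxi). Qed.

Lemma fuzzy_left_le {x y : R} : l <= x -> x <= y -> y <= m1 -> xi x <= xi y.
Proof.
move=> lx xy ym; apply: (fuzzy_left_homo hxi) => //; rewrite in_itv /=.
  by rewrite lx (le_trans xy).
by rewrite ym (le_trans lx).
Qed.

Lemma fuzzy_ge0_le1 {x : R} : l <= x -> 0 <= xi x <= 1.
Proof.
move=> lx; have : `[0, 1]%classic (xi x); last by rewrite /= in_itv.
apply: (fuzzy_fun hxi); rewrite /= in_itv /= andbT.
exact: le_trans fuzzy_lo_ge0 lx.
Qed.

Lemma fuzzy_core_lo : xi m1 = 1.
Proof.
have [_ _ m12 _] := fuzzy_order hxi.
have : `[m1, m2]%classic m1 by rewrite /= in_itv /= lexx m12.
by rewrite -(fuzzy_core hxi) => -[].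
Qed.

Lemma fuzzy_lt1 {x : R} : l <= x -> x < m1 -> xi x < 1.
Proof.
move=> lx xm; have /andP[_ x1] := fuzzy_ge0_le1 lx.
rewrite lt_neqAle x1 andbT; apply/eqP => xi1.
have : [set x | 0 <= x /\ xi x = 1] x.
  by split=> //; exact: le_trans fuzzy_lo_ge0 lx.
by rewrite (fuzzy_core hxi) /= in_itv /= leNgt xm.
Qed.

(** Since [l] lies in the closure of the positivity set, that set meets the neighbourhood of [l]
    formed by the points below [x]. The point [y] found there lies in the support, hence
    [l <= y < x], and monotonicity carries positivity from [y] to [x]. *)
Lemma fuzzy_gt0 {x : R} : l < x -> x <= m1 -> 0 < xi x.
Proof.
move=> lx xm; have [_ lm m12 mr] := fuzzy_order hxi.
have : `[l, r]%classic l.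
  by rewrite /= in_itv /= lexx (le_trans lm) // (le_trans m12).
rewrite -(fuzzy_supp hxi) => /(_ _ (lt_nbhsl lx))[y [[y0 xiy] yx]].
have : `[l, r]%classic y.
  by rewrite -(fuzzy_supp hxi); apply: subset_closure.
rewrite /= in_itv /= => /andP[ly _].
exact: lt_le_trans xiy (fuzzy_left_le ly (ltW yx) xm).
Qed.

Lemma supp_left_endpoint : supp xi_l = `[l, m1]%classic.
Proof.
have lm := fuzzy_lo_le_core.
apply/seteqP; split => [x|x].
  rewrite /supp => /(closure_subset (B := `[l, m1]%classic)).
  rewrite -(proj1 (closure_id _)); last exact: itv_closed.
  by apply=> y /=; rewrite in_itv; exact: left_endpoint_gt0_in.
rewrite /= in_itv /= => /andP[lx xm].
(* If [l = m1], no point of the interval approaches [l] from the right, but the single point has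
   value 1. *)
have [lm1|ml] := ltP l m1; last first.
  have -> : x = m1 by apply/eqP; rewrite eq_le xm (le_trans ml).
  by apply: subset_closure; rewrite /= left_endpoint_in ?lm ?lexx// fuzzy_core_lo.
have pos y : l < y -> y <= m1 -> 0 < xi_l y.
  by move=> ly ym; rewrite left_endpoint_in ?ym ?ltW // fuzzy_gt0.
move: lx; rewrite le_eqVlt => /predU1P[<-|lx]; last first.
  by apply: subset_closure; exact: pos.
(* [xi l] may be 0, so [l] is reached as a limit of points of []l, m1]], where [xi_l] is
   positive. *)
move=> B Bl; near (l^'+)%classic => y; exists y; split; last first.
  by near: y; exact: cvg_at_right_filter Bl.
by apply: pos; near: y; [exact: nbhs_right_gt|exact: nbhs_right_le].
Unshelve. all: by end_near.
Qed.

Lemma lt_gen_inverse {x alpha : R} : l <= x -> x < m1 ->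
  0 < alpha -> alpha <= 1 -> (x < xi_d alpha) = (xi x < alpha).
Proof.
move=> lx xm a0 a1; rewrite /gen_inverse gt_eqF //.
apply/idP/idP => [|xa].
  (* If [alpha <= xi x], then [x] belongs to the level set, whose infimum is thus at most [x]. The
     level set is bounded below by [l] because [0 < alpha] keeps it inside the support. *)
  apply: contraLR; rewrite -!leNgt => ax; apply: ge_inf.
    by exists l => z /(lt_le_trans a0)/left_endpoint_gt0_in/andP[].
  by rewrite /= left_endpoint_in // lx ltW.
(* An infimum only inherits large inequalities; right continuity provides a [y] strictly beyond [x]
   that still bounds the level set from below. *)
have [y [xy ym ya]] : exists y, [/\ x < y, y < m1 & xi y < alpha].
  have Ax : `[l, m1]%classic x by rewrite /= in_itv /= lx ltW.
  have near_lt : \forall y \near x^'+, `[l, m1]%classic y -> xi y < alpha.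
    exact: (fuzzy_left_cont hxi Ax (lt_nbhsl xa)).
  near (x^'+)%classic => y; exists y; split.
  - by near: y; exact: nbhs_right_gt.
  - by near: y; exact: nbhs_right_lt.
  - have: `[l, m1]%classic y.
      rewrite /= in_itv /=; apply/andP; split; last first.
        by near: y; exact: nbhs_right_le.
      by apply: (le_trans lx); near: y; exact: nbhs_right_ge.
    by near: y.
apply: (lt_le_trans xy); apply: lb_le_inf.
  (* The level set contains [m1], so its infimum is not the default value of an empty set. *)
  by exists m1; rewrite /= left_endpoint_in ?fuzzy_lo_le_core ?lexx// fuzzy_core_lo.
move=> z /= az.
have zin := left_endpoint_gt0_in (lt_le_trans a0 az).
rewrite leNgt; apply/negP => zy; move: az.
rewrite left_endpoint_in // leNgt => /negP; apply; apply: le_lt_trans ya.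
by case/andP: zin => lz _; exact: fuzzy_left_le lz (ltW zy) (ltW ym).
Unshelve. all: by end_near.
Qed.

End LeftEndpoint.

Theorem lemma2p5 (R : realType) (xi : R -> R) (l m1 m2 r : R)
    (hxi : fuzzy_interval xi l m1 m2 r) (x : R) :
  let xi_l := left_endpoint xi l m1 in
  let xi_d := gen_inverse xi_l in
  reinversion (supp xi_l) xi_d x = xi_l x.
Proof.
move=> xi_l xi_d; have lm := fuzzy_lo_le_core hxi.
have suppE := supp_left_endpoint hxi.
have infS : inf (supp xi_l) = l by rewrite suppE inf_itv // bnd_simp.
have supS : sup (supp xi_l) = m1 by rewrite suppE sup_itv // bnd_simp.
rewrite /reinversion infS supS; case: ifPn => [/andP[lx xm]|xout]; last first.
  have [->|xm1] := eqVneq x m1.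
    by rewrite /xi_l left_endpoint_in ?lm ?lexx // (fuzzy_core_lo hxi).
  (* Once [x = m1] is excluded, the closed and half-open interval tests agree, so both sides are
     0. *)
  by rewrite /xi_l /left_endpoint (le_eqVlt x m1) (negPf xm1) /= (negPf xout).
rewrite /xi_l left_endpoint_in; last by rewrite lx ltW.
have /andP[xi0 _] := fuzzy_ge0_le1 hxi lx.
suff -> : [set alpha | 0 <= alpha <= 1 /\ x < xi_d alpha]%classic
          = `]xi x, 1]%classic.
  by rewrite inf_itv // bnd_simp (fuzzy_lt1 hxi).
apply/seteqP; split=> [a [/andP[+ a1]]|a] /=; rewrite in_itv /=.
  (* The level 0 is outside the equivalence, but [xi_d 0 = l <= x] excludes it from the set. *)
  rewrite (le_eqVlt 0) => /predU1P[<-|a0].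
    by rewrite /xi_d /gen_inverse eqxx infS ltNge lx.
  by rewrite (lt_gen_inverse hxi) // => ->.
move=> /andP[xa a1]; have a0 := le_lt_trans xi0 xa.
by rewrite a1 (ltW a0) (lt_gen_inverse hxi).
Qed.
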